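(* For every positive integer $m$ there exists an infinite family of (pairwise different) virtual knots $K$ with unknotting index $U(K)=(0,m)$.
   Context: A virtual knot diagram is a generic immersion of one circle in the plane whose double points are each marked either as a classical crossing (with over/under information) or as a virtual crossing (no over/under information). Two diagrams are equivalent if they are related by a finite sequence of classical Reidemeister moves RI, RII, RIII, virtual Reidemeister moves VRI, VRII, VRIII (the analogues of RI, RII, RIII in which all crossings are virtual), and the semi-virtual move SV (moving an arc having only virtual crossings across a classical crossing), together with planar isotopy. A virtual knot $K$ is an equivalence class of virtual knot diagrams; $[K]$ denotes the set of its diagrams. The trivial knot is the class of the crossingless circle. Virtualizing a classical crossing means replacing it by a virtual crossing; a crossing change means exchanging the over and under strands at a classical crossing. For non-negative integers $n,m$, a virtual knot diagram $D$ is $(n,m)$-unknottable if, by virtualizing $n$ classical crossings of $D$ and applying crossing changes at $m$ classical crossings of $D$, one obtains a diagram of the trivial knot. The unknotting index $U(D)$ of the diagram $D$ is the minimum, in the dictionary (lexicographic) order, of all pairs $(n,m)$ such that $D$ is $(n,m)$-unknottable. The unknotting index of a virtual knot $K$ is $U(K)=\min\{U(D) : D\in [K]\}$, the minimum again being taken in the dictionary order. *)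

(* Defs.v *)
From Stdlib Require Import Relation_Operators.
From mathcomp Require Import all_boot all_order.
From mathcomp Require Import boolp classical_sets.

Set Implicit Arguments.
Unset Strict Implicit.
Unset Printing Implicit Defensive.

Local Open Scope classical_set_scope.
Local Open Scope nat_scope.

(* A generic immersion of closed curves in the plane is put in Morse position
   with respect to the height function and cut, from bottom to top, into
   horizontal slices containing exactly one local minimum (Cup), local maximum
   (Cap) or double point.  The slice (i, t) shows the tile t with exactly i
   vertical strands to its left. *)

(* At [Classical b], the over strand is the one going from bottom left to top
   right if b = true, from bottom right to top left if b = false. *)
Variant crossing := Classical of bool | Virtual.

Variant tile := Cup | Cap | Cross of crossing.

Definition slice : Type := (nat * tile)%type.

Definition diagram : Type := seq slice.

Definition ends_below (t : tile) : nat := if t is Cup then 0 else 2.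
Definition ends_above (t : tile) : nat := if t is Cap then 0 else 2.

(* [fits n D]: the slices of D can be stacked above n strands, and no strand is
   left at the top. *)
Fixpoint fits (n : nat) (D : diagram) : bool :=
  if D is (i, t) :: D' then
    (i + ends_below t <= n) && fits (n - ends_below t + ends_above t) D'
  else n == 0.

(* Diagrams of closed curves, with any number of components. *)
Definition closed_diagram (D : diagram) : bool := fits 0 D.

(* The number of strands meeting the horizontal line just below slice k. *)
Definition width (D : diagram) (k : nat) : nat :=
  foldl (fun n (s : slice) => n - ends_below s.2 + ends_above s.2) 0 (take k D).

(* (k, p) stands for the point of the curve at position p (counted from the
   left) on the line just below slice k.  The strand pieces inside slice k join
   such points; at a double point each branch goes straight through. *)
Inductive strand_piece (D : diagram) : nat * nat -> nat * nat -> Prop :=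
| piece_left k i t p of onth D k = Some (i, t) & p < i :
    strand_piece D (k, p) (k.+1, p)
| piece_right k i t p of onth D k = Some (i, t)
    & i + ends_below t + p < width D k :
    strand_piece D (k, i + ends_below t + p) (k.+1, i + ends_above t + p)
| piece_cup k i of onth D k = Some (i, Cup) :
    strand_piece D (k.+1, i) (k.+1, i.+1)
| piece_cap k i of onth D k = Some (i, Cap) :
    strand_piece D (k, i) (k, i.+1)
| piece_rising k i c of onth D k = Some (i, Cross c) :
    strand_piece D (k, i) (k.+1, i.+1)
| piece_falling k i c of onth D k = Some (i, Cross c) :
    strand_piece D (k, i.+1) (k.+1, i).

Definition one_component (D : diagram) : Prop :=
  0 < size D /\
  forall k p l q, p < width D k -> q < width D l ->
    clos_refl_sym_trans _ (strand_piece D) (k, p) (l, q).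

Definition knot_diagram (D : diagram) : Prop :=
  closed_diagram D /\ one_component D.

(* Crossing change; it is also the effect on a crossing of a reflection in a
   vertical line that preserves the over strand. *)
Definition change (c : crossing) : crossing :=
  if c is Classical b then Classical (~~ b) else Virtual.

(* Planar isotopy of diagrams in Morse position: exchange of the heights of two
   distant tiles, cancellation of a minimum against a maximum, and a strand
   crossing one leg of a minimum or maximum passing to the other leg. *)
Inductive planar_isotopy : diagram -> diagram -> Prop :=
| iso_exchange i t d t' :
    planar_isotopy [:: (i, t); (i + ends_above t + d, t')]
                   [:: (i + ends_below t + d, t'); (i, t)]
| iso_zigzag_left i : planar_isotopy [:: (i.+1, Cup); (i, Cap)] [::]
| iso_zigzag_right i : planar_isotopy [:: (i, Cup); (i.+1, Cap)] [::]
| iso_slide_cap i c :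
    planar_isotopy [:: (i, Cross c); (i.+1, Cap)]
                   [:: (i.+1, Cross (change c)); (i, Cap)]
| iso_slide_cup i c :
    planar_isotopy [:: (i.+1, Cup); (i, Cross c)]
                   [:: (i, Cup); (i.+1, Cross (change c))].

(* The first and second Reidemeister moves; the crossings are classical in RI
   and RII, virtual in VRI and VRII. *)
Inductive move_I (c : crossing) : diagram -> diagram -> Prop :=
| I_cup i : move_I c [:: (i, Cup); (i, Cross c)] [:: (i, Cup)]
| I_cap i : move_I c [:: (i, Cross c); (i, Cap)] [:: (i, Cap)].

Inductive move_II (c : crossing) : diagram -> diagram -> Prop :=
| II i : move_II c [:: (i, Cross c); (i, Cross (change c))] [::].

(* Three strands numbered 1, 2, 3 from left to right at the bottom, cxy being
   the crossing of the strands x and y. *)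
Inductive triangle_move (c12 c13 c23 : crossing) : diagram -> diagram -> Prop :=
| triangle i :
    triangle_move c12 c13 c23
      [:: (i, Cross c12); (i.+1, Cross c13); (i, Cross c23)]
      [:: (i.+1, Cross c23); (i, Cross c13); (i.+1, Cross c12)].

Inductive reidemeister : diagram -> diagram -> Prop :=
| RI b D E of move_I (Classical b) D E : reidemeister D E
| RII b D E of move_II (Classical b) D E : reidemeister D E
(* The side condition says that the three strands lie at three levels: it rules
   out 1 over 2 over 3 over 1 and 1 under 2 under 3 under 1. *)
| RIII b12 b13 b23 D E of b13 = b12 \/ b13 = b23
    & triangle_move (Classical b12) (Classical b13) (Classical b23) D E :
    reidemeister D E.

Inductive virtual_reidemeister : diagram -> diagram -> Prop :=
| VRI D E of move_I Virtual D E : virtual_reidemeister D E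
| VRII D E of move_II Virtual D E : virtual_reidemeister D E
| VRIII D E of triangle_move Virtual Virtual Virtual D E :
    virtual_reidemeister D E.

(* The moved arc is strand 3, 2, 1 respectively. *)
Inductive semi_virtual : diagram -> diagram -> Prop :=
| SV3 b D E of triangle_move (Classical b) Virtual Virtual D E :
    semi_virtual D E
| SV2 b D E of triangle_move Virtual (Classical b) Virtual D E :
    semi_virtual D E
| SV1 b D E of triangle_move Virtual Virtual (Classical b) D E :
    semi_virtual D E.

Definition local_move (D E : diagram) : Prop :=
  [\/ planar_isotopy D E, reidemeister D E, virtual_reidemeister D E
    | semi_virtual D E].

(* No move changes the number of components, so there is no need to require
   one component along the way. *)
Inductive move : diagram -> diagram -> Prop :=
| Move below above D E of local_move D E
    & closed_diagram (below ++ D ++ above)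
    & closed_diagram (below ++ E ++ above) :
    move (below ++ D ++ above) (below ++ E ++ above).

Definition equivalent : diagram -> diagram -> Prop :=
  clos_refl_sym_trans diagram move.

Record virtual_knot : Type := VirtualKnot {
  diagrams : set diagram;
  _ : exists2 D, knot_diagram D &
      diagrams = [set E | knot_diagram E /\ equivalent D E]
}.

Definition circle : diagram := [:: (0, Cup); (0, Cap)].

Definition trivial_diagram (D : diagram) : Prop := equivalent D circle.

(* [modified n m D E]: E is obtained from D by virtualizing n classical
   crossings and changing m other classical crossings. *)
Inductive modified : nat -> nat -> diagram -> diagram -> Prop :=
| modified_nil : modified 0 0 [::] [::]
| modified_keep n m s D E of modified n m D E :
    modified n m (s :: D) (s :: E)
| modified_virtualize n m i b D E of modified n m D E :
    modified n.+1 m ((i, Cross (Classical b)) :: D) ((i, Cross Virtual) :: E)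
| modified_change n m i b D E of modified n m D E :
    modified n m.+1 ((i, Cross (Classical b)) :: D)
                    ((i, Cross (change (Classical b))) :: E).

Definition unknottable (n m : nat) (D : diagram) : Prop :=
  exists2 E, modified n m D E & trivial_diagram E.

(* [nat *l nat] carries the dictionary order. *)
Definition is_min (S : set (nat *l nat)) (p : nat *l nat) : Prop :=
  S p /\ forall q, S q -> (p <= q)%O.

(* U(D) = p *)
Definition diagram_unknotting_index (D : diagram) (p : nat *l nat) : Prop :=
  is_min [set q | unknottable q.1 q.2 D] p.

(* U(K) = p *)
Definition unknotting_index (K : virtual_knot) (p : nat *l nat) : Prop :=
  is_min [set q | exists2 D, diagrams K D & diagram_unknotting_index D q] p.

(* Main.v *)
(* Label the strands of an oriented diagram by integers so that a strand gains
   (loses) 1 whenever it meets, at a classical crossing, a strand coming from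
   its right (left).  The index of a classical crossing is the label of its over
   strand minus that of its under strand, and for n <> 0 the n-writhe J_n, the
   sum of the signs of the crossings of index n, is a virtual knot invariant
   (Cheng-Gao, Kauffman, Satoh-Taniguchi).  A crossing change negates the sign
   and the index of that crossing and leaves the labels unchanged, so J_n moves
   by at most 1, and a knot with J_n = m needs at least m crossing changes if
   nothing is virtualized.

   The n-th knot of the family has m clasps between two strands whose labels
   differ by n, because one of them runs through n kinks alternating classical
   and virtual crossings.  Its only nonzero writhes with nonzero index are
   J_n = J_(-n) = m, and m crossing changes undo the clasps. *)

From Stdlib Require Import Relation_Operators.
Require Import Defs.
From mathcomp Require Import all_boot all_order all_algebra.
From mathcomp Require Import boolp zify.

Set Implicit Arguments.
Unset Strict Implicit.
Unset Printing Implicit Defensive.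

Import Order.TTheory GRing.Theory Num.Theory.
Local Open Scope ring_scope.

(** * Labelled diagrams and their writhes *)

(* (o, a): a strand carrying the integer a, oriented upwards if o = true. *)
Definition label : Type := (bool * int)%type.

Definition flip (x : label) : label := (~~ x.1, x.2).

Definition sgnb (o : bool) : int := if o then 1 else -1.

(** Upward change in the label of the strand met by one of orientation [o]. The orientation of the
    shifted strand is irrelevant: reversing it exchanges its left and right, but also its two
    ends. *)
Definition shear (c : crossing) (o : bool) : int :=
  if c is Classical _ then sgnb o else 0.

Definition out_left (c : crossing) (x y : label) : label :=
  (y.1, y.2 - shear c x.1).
Definition out_right (c : crossing) (x y : label) : label :=
  (x.1, x.2 + shear c y.1).

(* The labels jump at a crossing, so the difference is taken between the means
   of the labels just below and just above it, (sgnb x.1 + sgnb y.1) / 2 being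
   written without a division. *)
Definition gap (x y : label) : int := x.2 - y.2 + (x.1%:Z + y.1%:Z - 1).

(** [sgnb (b == (x.1 == y.1))] is the sign of the crossing: positive for parallel strands with
    [b = true], and negated by reversing one strand. *)
Definition weight (n : int) (c : crossing) (x y : label) : int :=
  if c is Classical b then
    if (if b then gap x y else - gap x y) == n then sgnb (b == (x.1 == y.1))
    else 0
  else 0.

Definition tile_run (n : int) (t : tile) (s s' : seq label) (w : int) : Prop :=
  match t with
  | Cup => exists x, s' = x :: flip x :: s /\ w = 0
  | Cap => exists x, s = x :: flip x :: s' /\ w = 0
  | Cross c => exists x y r, [/\ s = x :: y :: r,
      s' = out_left c x y :: out_right c x y :: r & w = weight n c x y]
  end.

Fixpoint slice_run (n : int) (i : nat) (t : tile) (s s' : seq label) (w : int)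
    : Prop :=
  if i is j.+1 then
    exists x r r', [/\ s = x :: r, s' = x :: r' & slice_run n j t r r' w]
  else tile_run n t s s' w.

(* [run n D s s' w]: D has a labelling with boundary labels s at the bottom and
   s' at the top for which the n-writhe is w.  The orientation and the labels
   are part of the data, so links and tangles need no special treatment. *)
Fixpoint run (n : int) (D : diagram) (s s' : seq label) (w : int) : Prop :=
  if D is (i, t) :: D' then
    exists u w1 w2,
      [/\ slice_run n i t s u w1, run n D' u s' w2 & w = w1 + w2]
  else s = s' /\ w = 0.

(** * Composing and shifting runs *)

Lemma run_cat n D E s s' w :
  run n (D ++ E) s s' w <->
  exists u w1 w2, [/\ run n D s u w1, run n E u s' w2 & w = w1 + w2].
Proof.
elim: D s w => [|[i t] D IH] s w /=.
  split=> [H|[u [w1 [w2 [[-> ->] H ->]]]]]; last by rewrite add0r.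
  by exists s, 0, w; rewrite add0r.
split=> [[u [w1 [w2 [H1 /IH [v [w3 [w4 [H3 H4 ->]]]] ->]]]]|].
  exists v, (w1 + w3), w4; split=> //; last by rewrite addrA.
  by exists u, w1, w3.
move=> [v [w3 [w4 [[u [w1 [w2 [H1 H2 ->]]]] H4 ->]]]].
exists u, w1, (w2 + w4); split=> //; last by rewrite addrA.
by apply/IH; exists v, w2, w4.
Qed.

(** The arbitrary [r'] says that a tile ignores the strands to its right; this is what lets two
    distant tiles exchange heights. *)
Lemma tile_run_local n t s s' w :
  tile_run n t s s' w <->
  exists l l' r, [/\ s = l ++ r, s' = l' ++ r, size l = ends_below t,
    size l' = ends_above t & forall r', tile_run n t (l ++ r') (l' ++ r') w].
Proof.
split=> [|[l [l' [r [-> -> _ _]]]]]; last by apply.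
case: t => [|| c] /=.
- move=> [x [-> ->]]; exists [::], [:: x; flip x], s.
  by split=> // r'; exists x.
- move=> [x [-> ->]]; exists [:: x; flip x], [::], s'.
  by split=> // r'; exists x.
move=> [x [y [r [-> -> ->]]]].
exists [:: x; y], [:: out_left c x y; out_right c x y], r.
by split=> // r'; exists x, y, r'.
Qed.

Lemma slice_run_cat n l i t s s' w :
  slice_run n (size l + i) t (l ++ s) s' w <->
  exists2 r, s' = l ++ r & slice_run n i t s r w.
Proof.
elim: l s' => [|x l IH] s' /=.
  by split=> [H|[r -> //]]; exists s'.
split=> [[y [r [r' [[-> <-] -> /IH [r'' -> H]]]]]|[r -> H]].
  by exists r''.
by exists x, (l ++ s), (l ++ r); split=> //; apply/IH; exists r.
Qed.

Lemma slice_run_size n i t s s' w :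
  slice_run n i t s s' w -> size s' = (size s - ends_below t + ends_above t)%N
    /\ (i + ends_below t <= size s)%N.
Proof.
elim: i s s' => [|i IH] s s' /=.
  move=> /tile_run_local [l [l' [r [-> -> E E' _]]]].
  by rewrite !size_cat E E'; lia.
move=> [x [r [r' [-> -> /IH [H1 H2]]]]] /=.
lia.
Qed.

Lemma run_fits n D E s s' w :
  run n D s s' w -> fits (size s) (D ++ E) = fits (size s') E.
Proof.
elim: D s w => [|[i t] D IH] s w /=; first by move=> [->].
move=> [u [w1 [w2 [/slice_run_size [H1 H2] /IH H _]]]].
by rewrite H2 -H1.
Qed.

Definition shift (i : nat) (D : diagram) : diagram :=
  [seq ((s.1 + i)%N, s.2) | s <- D].

(** Strands left of position [i] keep their labels, so each local move need only be checked at
    position 0. *)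
Lemma run_shift n i D s s' w : (i <= size s)%N ->
  run n (shift i D) s s' w <->
  exists2 r, s' = take i s ++ r & run n D (drop i s) r w.
Proof.
elim: D s s' w => [|[j t] D IH] s s' w le_i /=.
  split=> [[<- ->]|[r -> [<- ->]]]; last by rewrite cat_take_drop.
  by exists (drop i s); rewrite ?cat_take_drop.
have E : size (take i s) = i by rewrite size_takel.
rewrite -{1}(cat_take_drop i s).
split=> [[u [w1 [w2 []]]]|[r -> [u [w1 [w2 [H1 H2 ->]]]]]].
  rewrite addnC -{1}E => /slice_run_cat [r -> H1] H2 ->.
  have /IH : (i <= size (take i s ++ r))%N by rewrite size_cat E leq_addr.
  case/(_ s' w2) => + _ => /(_ H2) [r'].
  rewrite take_size_cat // drop_size_cat // => -> H.
  by exists r' => //; exists r, w1, w2.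
exists (take i s ++ u), w1, w2; split=> //.
  by rewrite addnC -{1}E; apply/slice_run_cat; exists u.
apply/IH; first by rewrite size_cat E leq_addr.
by rewrite take_size_cat // drop_size_cat //; exists r.
Qed.

(* The empty diagram runs on any number of labels, whereas a slice needs enough
   strands: hence the lower bound [k] on the number of labels. *)
Definition same_runs (n : int) (k : nat) (D E : diagram) : Prop :=
  forall s s' w, (k <= size s)%N -> run n D s s' w <-> run n E s s' w.

Lemma same_runs_shift n i k D E :
  same_runs n k D E -> same_runs n (k + i) (shift i D) (shift i E).
Proof.
move=> DE s s' w le_s.
split=> /run_shift [|r -> H]; try lia; apply/run_shift; try lia;
  by exists r => //; apply/DE=> //; rewrite size_drop; lia.
Qed.

(** * Local moves preserve runs *)

Lemma same_runs_exchange n t d t' :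
  same_runs n 0 [:: (0%N, t); ((ends_above t + d)%N, t')]
                [:: ((ends_below t + d)%N, t'); (0%N, t)].
Proof.
move=> s s' w _; split=> /=.
  move=> [u [w1 [w2 [/tile_run_local [l [l' [r [-> -> El El' Ht]]]]]]]].
  move=> [u' [w3 [w4 []]]].
  rewrite -El' => /slice_run_cat [r' -> H] [<- ->] -> ->.
  exists (l ++ r'), w3, w1; rewrite !addr0; split.
  - by rewrite -El; apply/slice_run_cat; exists r'.
  - by exists (l' ++ r'), w1, 0; rewrite addr0.
  - by rewrite addrC.
move=> [u [w1 [w2 [H]]]].
move=> [u' [w3 [w4 []]]] /tile_run_local [l [l' [r [Eu -> El El' Ht]]]].
move=> [<- ->] -> ->; rewrite addr0.
(* Here the left tile acts second: the labels it consumes must first be recognized as the initial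
   labels of [s], which the right tile leaves in place. *)
have [H1 H2] := slice_run_size H.
have le_s : (size l <= size s)%N by lia.
move: H; rewrite -El -(cat_take_drop (size l) s) -{1}(size_takel le_s).
move=> /slice_run_cat [r' Er' H].
move: Er'; rewrite Eu => /eqP; rewrite eqseq_cat ?size_takel // => /andP[].
move=> /eqP El2 /eqP Er; rewrite -El2.
exists (l' ++ drop (size l) s), w3, w1; split; first exact: Ht.
- exists (l' ++ r), w1, 0; rewrite addr0; split=> //.
  by rewrite -El'; apply/slice_run_cat; exists r' => //; rewrite Er.
- by rewrite addrC.
Qed.

(** Passing on the remaining writhe [w - w1], as an equality of propositions, makes runs of explicit
    tiles computable by rewriting. *)
Lemma run_cons n i t D s s' w :
  run n ((i, t) :: D) s s' w =
  exists u w1, slice_run n i t s u w1 /\ run n D u s' (w - w1).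
Proof.
apply/propext; split=> /=.
  move=> [u [w1 [w2 [H1 H2 ->]]]]; exists u, w1; split=> //.
  by rewrite addrC addKr.
move=> [u [w1 [H1 H2]]]; exists u, w1, (w - w1); split=> //.
by rewrite addrC subrK.
Qed.

Lemma run_cross n c D x y r s' w :
  run n ((0%N, Cross c) :: D) (x :: y :: r) s' w =
  run n D (out_left c x y :: out_right c x y :: r) s' (w - weight n c x y).
Proof.
rewrite run_cons; apply/propext; split.
  by move=> [u [w1 [[x' [y' [r' [[<- <- <-] -> ->]]]] H]]].
move=> H; exists (out_left c x y :: out_right c x y :: r), (weight n c x y).
by split=> //; exists x, y, r.
Qed.

Lemma run_cross1 n c D x y z r s' w :
  run n ((1%N, Cross c) :: D) (x :: y :: z :: r) s' w =
  run n D (x :: out_left c y z :: out_right c y z :: r) s'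
    (w - weight n c y z).
Proof.
rewrite run_cons; apply/propext; split.
  move=> [u [w1 [[x' [v [v' [[<- <-] -> H1]]]] H2]]].
  by move: H1 H2 => [y' [z' [r' [[<- <- <-] -> ->]]]].
move=> H.
exists (x :: out_left c y z :: out_right c y z :: r), (weight n c y z).
split=> //; exists x, (y :: z :: r), (out_left c y z :: out_right c y z :: r).
by split=> //; exists y, z, r.
Qed.

Lemma run_cap n D x y r s' w :
  run n ((0%N, Cap) :: D) (x :: y :: r) s' w =
  (y = flip x /\ run n D r s' w).
Proof.
rewrite run_cons; apply/propext; split.
  by move=> [u [w1 [[x' [[-> -> ->] ->]]]]]; rewrite subr0.
by move=> [-> H]; exists r, 0; rewrite subr0; split=> //; exists x.
Qed.

Lemma run_cap1 n D x y z r s' w :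
  run n ((1%N, Cap) :: D) (x :: y :: z :: r) s' w =
  (z = flip y /\ run n D (x :: r) s' w).
Proof.
rewrite run_cons; apply/propext; split.
  move=> [u [w1 [[x' [v [v' [[<- <-] -> H1]]]] H2]]].
  by move: H1 H2 => [y' [[-> -> ->] ->]]; rewrite subr0.
move=> [-> H]; exists (x :: r), 0; rewrite subr0; split=> //.
by exists x, (y :: flip y :: r), r; split=> //; exists y.
Qed.

Lemma run_cup n D s s' w :
  run n ((0%N, Cup) :: D) s s' w =
  exists x, run n D (x :: flip x :: s) s' w.
Proof.
rewrite run_cons; apply/propext; split.
  by move=> [u [w1 [[x [-> ->]]]]]; rewrite subr0; exists x.
move=> [x H]; exists (x :: flip x :: s), 0; rewrite subr0.
by split=> //; exists x.
Qed.

Lemma run_cup1 n D x s s' w :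
  run n ((1%N, Cup) :: D) (x :: s) s' w =
  exists y, run n D (x :: y :: flip y :: s) s' w.
Proof.
rewrite run_cons; apply/propext; split.
  move=> [u [w1 [[x' [v [v' [[<- <-] -> H1]]]] H2]]].
  by move: H1 H2 => [y [-> ->]]; rewrite subr0; exists y.
move=> [y H]; exists (x :: y :: flip y :: s), 0; rewrite subr0.
by split=> //; exists x, s, (y :: flip y :: s); split=> //; exists y.
Qed.

Lemma flipK x : flip (flip x) = x.
Proof. by case: x => o a; rewrite /flip /= negbK. Qed.

Lemma same_runs_zigzag_left n :
  same_runs n 1 [:: (1%N, Cup); (0%N, Cap)] [::].
Proof.
move=> [|x s] s' w // _; rewrite run_cup1.
split=> [[y]|[<- ->]].
  by rewrite run_cap => -[-> [<- ->]]; rewrite flipK.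
by exists (flip x); rewrite run_cap flipK.
Qed.

Lemma same_runs_zigzag_right n :
  same_runs n 1 [:: (0%N, Cup); (1%N, Cap)] [::].
Proof.
move=> [|x s] s' w // _; rewrite run_cup.
split=> [[y]|[<- ->]].
  by rewrite run_cap1 => -[-> [<- ->]]; rewrite flipK.
by exists x; rewrite run_cap1 flipK.
Qed.

Ltac label_solve :=
  repeat match goal with x : label |- _ => case: x; intros [] ? end;
  repeat match goal with b : bool |- _ => case: b end;
  rewrite /weight /gap /out_left /out_right /flip /sgnb /=;
  repeat case: eqP => ? /=; try congr (_, _); try lia.

Lemma out_left_change c x y :
  out_left (change c) (out_left c x y) (out_right c x y) = x.
Proof. case: c => [b|]; label_solve. Qed.

Lemma out_right_change c x y :
  out_right (change c) (out_left c x y) (out_right c x y) = y.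
Proof. case: c => [b|]; label_solve. Qed.

(** The two crossings of a second Reidemeister move have the same index and opposite signs. *)
Lemma weight_change_out n c x y :
  weight n (change c) (out_left c x y) (out_right c x y) = - weight n c x y.
Proof. case: c => [b|]; label_solve. Qed.

Lemma same_runs_II n c :
  same_runs n 2 [:: (0%N, Cross c); (0%N, Cross (change c))] [::].
Proof.
move=> [|x [|y s]] s' w // _.
rewrite !run_cross out_left_change out_right_change weight_change_out.
by rewrite opprK subrK.
Qed.

(** A kink crosses an arc with itself, and the two mean labels there agree: its index is 0. This is
    where the writhe of index 0 has to be excluded. *)
Lemma weight_flip n c x : n != 0 -> weight n c x (flip x) = 0.
Proof. by move=> n0; case: c => [b|//]; label_solve. Qed.

Lemma out_right_flip c x :
  out_right c x (flip x) = flip (out_left c x (flip x)).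
Proof. case: c => [b|]; label_solve. Qed.

Lemma out_left_flip_surj c y : exists x, out_left c x (flip x) = y.
Proof.
exists (~~ y.1, y.2 + shear c (~~ y.1)).
by case: y => o a; rewrite /out_left /= negbK addrK.
Qed.

Lemma out_flip c x y : out_right c x y = flip (out_left c x y) -> y = flip x.
Proof.
by case: c x y => [b|] [[] a] [[] a'] //= []; rewrite /flip /=; move=> ?;
  congr (_, _); lia.
Qed.

Lemma same_runs_I_cup n c : n != 0 ->
  same_runs n 0 [:: (0%N, Cup); (0%N, Cross c)] [:: (0%N, Cup)].
Proof.
move=> n0 s s' w _; rewrite !run_cup; split=> -[x].
  rewrite run_cross weight_flip // subr0 out_right_flip => H.
  by exists (out_left c x (flip x)).
have [y <-] := out_left_flip_surj c x => H; exists y.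
by rewrite run_cross weight_flip // subr0 out_right_flip.
Qed.

Lemma same_runs_I_cap n c : n != 0 ->
  same_runs n 2 [:: (0%N, Cross c); (0%N, Cap)] [:: (0%N, Cap)].
Proof.
move=> n0 [|x [|y s]] s' w // _; rewrite run_cross !run_cap.
split=> [[/out_flip ->]|[-> H]]; first by rewrite weight_flip // subr0.
by rewrite out_right_flip weight_flip // subr0.
Qed.

(** The strand [y] crosses the arc from [x] to [z] on its left or on its right leg. The legs have
    opposite orientations, which [change] compensates in the sign and in the index. *)
Lemma same_runs_slide_cap n c :
  same_runs n 3 [:: (0%N, Cross c); (1%N, Cap)]
                [:: (1%N, Cross (change c)); (0%N, Cap)].
Proof.
move=> [|x [|y [|z s]]] s' w // _.
rewrite run_cross run_cap1 run_cross1 run_cap.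
have out_iff : z = flip (out_right c x y) <-> out_left (change c) y z = flip x.
  by case: c x y z => [b|] [[] a] [[] a'] [[] a''];
    split=> // -[?]; congr (_, _); rewrite ?/shear /=; lia.
have out_eq : z = flip (out_right c x y) ->
    out_right (change c) y z = out_left c x y.
  by move=> ->; case: c {out_iff} => [b|]; label_solve.
have weight_eq : z = flip (out_right c x y) ->
    weight n (change c) y z = weight n c x y.
  by move=> ->; case: c {out_iff out_eq} => [b|//]; label_solve.
by split=> [[H]|[/out_iff H]]; rewrite out_eq // weight_eq // => K;
  split=> //; apply/out_iff.
Qed.

Lemma same_runs_slide_cup n c :
  same_runs n 1 [:: (1%N, Cup); (0%N, Cross c)]
                [:: (0%N, Cup); (1%N, Cross (change c))].
Proof.
move=> [|x s] s' w // _; rewrite run_cup1 run_cup.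
have out_left_eq y :
    out_left (change c) (flip (out_left c x y)) x = out_right c x y.
  by case: c => [b|]; label_solve.
have out_right_eq y :
    out_right (change c) (flip (out_left c x y)) x = flip y.
  by case: c {out_left_eq} => [b|]; label_solve.
have weight_eq y :
    weight n (change c) (flip (out_left c x y)) x = weight n c x y.
  by case: c {out_left_eq out_right_eq} => [b|//]; label_solve.
split=> [[y]|[z]].
  rewrite run_cross => H; exists (out_left c x y).
  by rewrite run_cross1 out_left_eq out_right_eq weight_eq.
(* The left leg leaves with label [out_left c x y] on one side and [z] on the other; undoing the
   shift at the crossing recovers [y]. *)
have [y <-] : exists y, out_left c x y = z.
  exists (z.1, z.2 + shear c x.1).
  by case: z => o a; rewrite /out_left /= addrK.
rewrite run_cross1 out_left_eq out_right_eq weight_eq => H.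
by exists y; rewrite run_cross.
Qed.

(** Leaving one crossing free beside two virtual ones covers the semi-virtual moves and VRIII
    together. Triangles with exactly one virtual crossing, the forbidden moves, are absent. *)
Variant triangle_crossings : crossing -> crossing -> crossing -> Prop :=
| triangle_classical b12 b13 b23 :
    triangle_crossings (Classical b12) (Classical b13) (Classical b23)
| triangle_over1 c23 : triangle_crossings Virtual Virtual c23
| triangle_over2 c13 : triangle_crossings Virtual c13 Virtual
| triangle_over3 c12 : triangle_crossings c12 Virtual Virtual.

Lemma weight_gap n c x y x' y' :
  x.1 = x'.1 -> y.1 = y'.1 -> gap x y = gap x' y' ->
  weight n c x y = weight n c x' y'.
Proof. by case: c => [b|//] Ex Ey Eg; rewrite /weight Eg Ex Ey. Qed.

Section Triangle.
Variables (n : int) (c12 c13 c23 : crossing).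
Hypothesis c_ok : triangle_crossings c12 c13 c23.
Variables x y z : label.

Let x1 := out_right c12 x y.
Let y1 := out_left c12 x y.
Let x2 := out_right c13 x1 z.
Let z1 := out_left c13 x1 z.
Let z1' := out_left c23 y z.
Let y1' := out_right c23 y z.
Let x1' := out_right c13 x z1'.

Ltac label_eq :=
  rewrite /x2 /z1 /x1 /y1 /x1' /y1' /z1' /out_left /out_right /=;
  by congr (_, _); case: c_ok => /= *; lia.

Lemma triangle_left : out_left c23 y1 z1 = out_left c13 x z1'.
Proof. label_eq. Qed.

Lemma triangle_middle : out_right c23 y1 z1 = out_left c12 x1' y1'.
Proof. label_eq. Qed.

Lemma triangle_right : x2 = out_right c12 x1' y1'.
Proof. label_eq. Qed.

Ltac weight_eq :=
  rewrite /z1 /x1 /y1 /x1' /y1' /z1';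
  case: c_ok => *; rewrite //; apply: weight_gap => //;
  by rewrite /gap /out_left /out_right /=; lia.

(** At a classical crossing of the triangle, the remaining strand meets both of its strands
    classically or both virtually. It therefore affects their label difference equally whether it
    passes below or above. *)
Lemma triangle_weight12 : weight n c12 x1' y1' = weight n c12 x y.
Proof. weight_eq. Qed.

Lemma triangle_weight13 : weight n c13 x z1' = weight n c13 x1 z.
Proof. weight_eq. Qed.

Lemma triangle_weight23 : weight n c23 y1 z1 = weight n c23 y z.
Proof. weight_eq. Qed.

End Triangle.

Lemma same_runs_triangle n c12 c13 c23 : triangle_crossings c12 c13 c23 ->
  same_runs n 3
    [:: (0%N, Cross c12); (1%N, Cross c13); (0%N, Cross c23)]
    [:: (1%N, Cross c23); (0%N, Cross c13); (1%N, Cross c12)].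
Proof.
move=> c_ok [|x [|y [|z s]]] s' w // _.
rewrite run_cross run_cross1 run_cross run_cross1 run_cross run_cross1.
rewrite (triangle_left c_ok) (triangle_middle c_ok) (triangle_right c_ok).
rewrite (triangle_weight12 _ c_ok) (triangle_weight13 _ c_ok).
rewrite (triangle_weight23 _ c_ok).
by rewrite (addrAC w) (addrAC (w - _)) (addrAC w).
Qed.

(** * Invariance of the writhe under equivalence *)

Definition closed_same_runs (n : int) (D E : diagram) : Prop :=
  forall above s s' w,
    fits (size s) (D ++ above) -> fits (size s) (E ++ above) ->
    run n D s s' w <-> run n E s s' w.

(** A [Move] requires both diagrams to be closed; the two [fits] conditions supply the number of
    strands that [same_runs] asks for. *)
Lemma closed_same_runs_shift n i k D E : same_runs n k D E ->
  (forall N above, fits N (shift i D ++ above) ->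
     fits N (shift i E ++ above) -> (k + i <= N)%N) ->
  closed_same_runs n (shift i D) (shift i E).
Proof.
move=> DE le_k above s s' w fitD fitE.
by apply: (same_runs_shift (i := i) DE); apply: le_k fitD fitE.
Qed.

Lemma planar_isotopy_runs n D E :
  planar_isotopy D E -> closed_same_runs n D E.
Proof.
case=> [i t d t'|i|i|i c|i c].
- have := @closed_same_runs_shift n i 0 _ _ (@same_runs_exchange n t d t').
  rewrite /shift /= add0n -!(addnC i) !addnA; apply=> N above; lia.
- apply: (closed_same_runs_shift (i := i) (@same_runs_zigzag_left n)).
  by move=> N above /=; lia.
- apply: (closed_same_runs_shift (i := i) (@same_runs_zigzag_right n)).
  by move=> N above /=; lia.
- apply: (closed_same_runs_shift (i := i) (@same_runs_slide_cap n c)).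
  by move=> N above /=; lia.
- apply: (closed_same_runs_shift (i := i) (@same_runs_slide_cup n c)).
  by move=> N above /=; lia.
Qed.

Lemma move_I_runs (n : int) c D E :
  n != 0 -> move_I c D E -> closed_same_runs n D E.
Proof.
move=> n0 [i|i].
- apply: (closed_same_runs_shift (i := i) (same_runs_I_cup c n0)).
  by move=> N above /=; lia.
- apply: (closed_same_runs_shift (i := i) (same_runs_I_cap c n0)).
  by move=> N above /=; lia.
Qed.

Lemma move_II_runs n c D E : move_II c D E -> closed_same_runs n D E.
Proof.
case=> i; apply: (closed_same_runs_shift (i := i) (@same_runs_II n c)).
by move=> N above /=; lia.
Qed.

Lemma triangle_move_runs n c12 c13 c23 D E :
  triangle_crossings c12 c13 c23 -> triangle_move c12 c13 c23 D E ->
  closed_same_runs n D E.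
Proof.
move=> c_ok [i].
apply: (closed_same_runs_shift (i := i) (same_runs_triangle n c_ok)).
by move=> N above /=; lia.
Qed.

Lemma local_move_runs (n : int) D E :
  n != 0 -> local_move D E -> closed_same_runs n D E.
Proof.
move=> n0 [|||].
- exact: planar_isotopy_runs.
- case=> [b D' E'|b D' E'|b12 b13 b23 D' E' _].
  + exact: (move_I_runs n0).
  + exact: move_II_runs.
  + by move=> H; apply: (triangle_move_runs _ _ H); constructor.
- case=> [D' E'|D' E'|D' E'].
  + exact: (move_I_runs n0).
  + exact: move_II_runs.
  + by move=> H; apply: (triangle_move_runs _ _ H); constructor.
- by case=> b D' E' H; apply: (triangle_move_runs _ _ H); constructor.
Qed.

Lemma move_run (n : int) D E w : n != 0 -> move D E ->
  run n D [::] [::] w <-> run n E [::] [::] w.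
Proof.
move=> n0 [below above {}D {}E DE fitD fitE].
(* A run of [below] ends with as many labels as there are strands under the local move, so
   closedness of the whole becomes [fits (size s)] of the upper part. *)
have same s s' v w' : run n below [::] s v ->
    run n D s s' w' <-> run n E s s' w'.
  move=> H; apply: (local_move_runs n0 DE (above := above)).
    by rewrite -(run_fits _ H).
  by rewrite -(run_fits _ H).
split=> /run_cat [u [w1 [w2 [H1 /run_cat [v [w3 [w4 [H3 H4 ->]]]] ->]]]];
  apply/run_cat; exists u, w1, (w3 + w4); split=> //;
  by apply/run_cat; exists v, w3, w4; split=> //; apply/(same _ _ _ _ H1).
Qed.

Lemma equivalent_run (n : int) D E w : n != 0 -> equivalent D E ->
  run n D [::] [::] w <-> run n E [::] [::] w.
Proof.
move=> n0; elim=> [{}D {}E /move_run|{}D|{}D {}E _|D1 D2 D3 _ H12 _ H23].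
- exact.
- by [].
- by move=> ->.
- by rewrite H12.
Qed.

(** * Effect of crossing changes *)

(** The two indices are opposite, so for [n != 0] at most one of the two weights is nonzero. *)
Lemma weight_change (n : int) b x y : n != 0 ->
  `|weight n (Classical b) x y - weight n (Classical (~~ b)) x y| <= 1.
Proof.
move=> /eqP n0; rewrite /weight /sgnb; move: (gap x y) => g.
by case: b; case: (x.1 == y.1) => /=; do 2 case: eqP => ? /=; lia.
Qed.

(** Labels do not see which strand is over, so the labelling of [D] serves for [E] and only the
    weights of the changed crossings differ. *)
Lemma modified_run (n : int) k D E s s' w : n != 0 ->
  modified 0 k D E -> run n D s s' w ->
  exists2 w', run n E s s' w' & `|w - w'| <= k%:Z.
Proof.
move=> n0; move Ez: 0%N => z mod_DE.
elim: mod_DE Ez s w =>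
  {z k D E} [|z k [i t] D E _ IH|//|z k i b D E _ IH] z0 s w.
- by move=> H; exists w => //; lia.
- move=> [u [w1 [w2 [H1 H2 ->]]]]; have [w' H' le_k] := IH z0 _ _ H2.
  by exists (w1 + w'); [exists u, w1, w' | lia].
move=> [u [w1 [w2 [H1 H2 ->]]]]; have [w' H' le_k] := IH z0 _ _ H2.
have [w1' H1' le_1] : exists2 w1',
    slice_run n i (Cross (change (Classical b))) s u w1' & `|w1 - w1'| <= 1.
  elim: i s u H1 {H2 H' IH} => [|i IH] s u /=.
    move=> [x [y [r [-> -> ->]]]].
    by exists (weight n (Classical (~~ b)) x y);
      [exists x, y, r | exact: weight_change].
  move=> [x [r [r' [-> -> /IH [w1' H le_1]]]]].
  by exists w1' => //; exists x, r, r'.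
by exists (w1' + w'); [exists u, w1', w' | lia].
Qed.

(** * The family and its writhes *)

Definition clasp (b : bool) : diagram :=
  [:: (1%N, Cross (Classical false)); (1%N, Cross (Classical b))].
Definition loop : diagram :=
  [:: (0%N, Cross (Classical true)); (0%N, Cross Virtual)].

Definition repeat (m : nat) (D : diagram) : diagram := flatten (nseq m D).

(* With b = false the two crossings of a clasp have the same sign and opposite
   indices; with b = true they cancel by RII. *)
Definition tower (b : bool) (m n : nat) : diagram :=
  [:: (0%N, Cup), (0%N, Cup) &
     repeat m (clasp b) ++ repeat n loop ++ [:: (1%N, Cap); (0%N, Cap)]].

Lemma repeatS m D E : repeat m.+1 D ++ E = D ++ repeat m D ++ E.
Proof. by rewrite /repeat /= catA. Qed.

Definition clasp_weight (k : int) (x y : label) : int :=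
  weight k (Classical false) x y +
  weight k (Classical false) (out_left (Classical false) x y)
                             (out_right (Classical false) x y).

Lemma run_clasps k m D x y z s s' w :
  run k (repeat m (clasp false) ++ D) (x :: y :: z :: s) s' w =
  run k D (x :: y :: z :: s) s' (w - clasp_weight k y z *+ m).
Proof.
elim: m w => [|m IH] w; first by rewrite mulr0n subr0.
rewrite repeatS /clasp !cat_cons cat0s !run_cross1.
(* As labels ignore over and under, the second crossing of the clasp restores them just as in a
   second Reidemeister move. *)
rewrite (out_left_change (Classical true)) (out_right_change (Classical true)).
by rewrite IH; congr run; rewrite mulrS /clasp_weight; lia.
Qed.

Definition slide (x : label) (a : int) : label := (x.1, x.2 + a).

(** Each classical kink shifts the label by one and swaps the two ends. The virtual kink swaps them
    back without a shift; otherwise the next classical kink would undo the first. *)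
Lemma run_loops (k : int) n D x s s' w : k != 0 ->
  run k (repeat n loop ++ D) (x :: flip x :: s) s' w =
  run k D
    (slide x (- (sgnb x.1 *+ n)) :: flip (slide x (- (sgnb x.1 *+ n))) :: s)
    s' w.
Proof.
move=> k0; elim: n x => [|n IH] x.
  by case: x => o a; rewrite /slide mulr0n subr0.
rewrite repeatS /loop !cat_cons cat0s !run_cross weight_flip // !subr0.
have -> : out_right (Classical true) x (flip x) = slide x (- sgnb x.1).
  by case: x => [[] a].
have -> : out_left (Classical true) x (flip x) = flip (slide x (- sgnb x.1)).
  by case: x => [[] a].
have -> y z : out_left Virtual y z = z.
  by case: z => o a; rewrite /out_left subr0.
have -> y z : out_right Virtual y z = y.
  by case: y => o a; rewrite /out_right addr0.
rewrite IH; congr run; rewrite /slide mulrS /= -addrA -opprD addrC //.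
Qed.

(** The cap at position 1 determines [y] from [x], and every choice of [x] gives the same writhe;
    the equivalence thus contains both existence and uniqueness of the value. *)
Lemma run_tower (k : int) m n w : (0 < n)%N -> k != 0 ->
  run k (tower false m n) [::] [::] w <->
  w = if `|k| == n%:Z then m%:Z else 0.
Proof.
move=> n_gt0 k0; rewrite /tower run_cup.
pose a : int := n%:Z.
(* Both crossings of the clasp are positive, with indices [n] and [-n] in some order. As [0 < n],
   these differ and only one of them can equal [k]. *)
have weight_eq x : clasp_weight k (flip x) (slide x (- (sgnb x.1 *+ n))) =
    if `|k| == n%:Z then 1 else 0.
  case: x => o a'; rewrite /clasp_weight /weight /gap /= /sgnb -mulr_natr.
  by case: o => /=; do 3 case: eqP => ? /=; lia.
have run_x x y w' : run k (repeat m (clasp false) ++ repeat n loop ++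
      [:: (1%N, Cap); (0%N, Cap)]) [:: x; flip x; y; flip y] [::] w' <->
    y = slide x (- (sgnb x.1 *+ n)) /\ w' = if `|k| == n%:Z then m%:Z else 0.
  rewrite run_clasps run_loops // run_cap1 run_cap flipK.
  split=> [[-> [_ [_]]]|[-> ->]].
    by rewrite weight_eq; case: ifP => _; rewrite ?mul0rn //; split=> //; lia.
  split=> //; split=> //=; split=> //.
  by rewrite weight_eq; case: ifP => _; rewrite ?mul0rn //; lia.
split=> [[y]|->]; first by rewrite run_cup => -[x /run_x []].
exists (slide (true, 0) (- (sgnb true *+ n))).
rewrite run_cup; exists (true, 0).
by apply/run_x.
Qed.

(** * Unknotting the towers *)

Lemma fits_repeat N m D E : (forall E', fits N (D ++ E') = fits N E') ->
  fits N (repeat m D ++ E) = fits N E.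
Proof. by move=> ND; elim: m => [//|m IH]; rewrite repeatS ND. Qed.

Lemma tower_closed b m n : closed_diagram (tower b m n).
Proof. by rewrite /closed_diagram /tower /= !fits_repeat. Qed.

Lemma equivalent_step D E :
  move D E -> equivalent E circle -> equivalent D circle.
Proof. by move=> DE Ec; apply: rst_trans Ec; apply: rst_step. Qed.

(** RII removes the clasps from the bottom. The kinks then lie directly on the second cup and go one
    by one by RI and VRI; a zigzag is left. *)
Lemma tower_trivial m n : trivial_diagram (tower true m n).
Proof.
rewrite /trivial_diagram; pose caps : diagram := [:: (1%N, Cap); (0%N, Cap)].
elim: m => [|m]; last first.
  apply: equivalent_step; rewrite /tower repeatS.
  pose above := repeat m (clasp true) ++ repeat n loop ++ caps.
  apply: (@Move [:: (0%N, Cup); (0%N, Cup)] above (clasp true) [::]).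
  - by apply: Or42; apply: RII; apply: (II _ 1).
  - by rewrite /closed_diagram /= !fits_repeat.
  - by rewrite /closed_diagram /= !fits_repeat.
elim: n => [|n IH].
  apply: equivalent_step (rst_refl _ _ _).
  apply: (@Move [:: (0%N, Cup)] [:: (0%N, Cap)]
            [:: (0%N, Cup); (1%N, Cap)] [::]) => //.
  by apply: Or41; apply: (iso_zigzag_right 0).
have remove_kink c D : fits 4 D -> local_move
    [:: (0%N, Cup); (0%N, Cross c)] [:: (0%N, Cup)] ->
    equivalent [:: (0%N, Cup), (0%N, Cup) & D] circle ->
    equivalent [:: (0%N, Cup), (0%N, Cup), (0%N, Cross c) & D] circle.
  move=> fitD moveD; apply: equivalent_step.
  by apply: (@Move [:: (0%N, Cup)] D
               [:: (0%N, Cup); (0%N, Cross c)] [:: (0%N, Cup)]).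
rewrite -[tower _ _ _]/[:: (0%N, Cup), (0%N, Cup) &
  repeat n.+1 loop ++ caps] repeatS.
apply: (remove_kink); first by rewrite /= fits_repeat.
  by apply: Or42; apply: RI; constructor.
apply: (remove_kink); first by rewrite fits_repeat.
  by apply: Or43; apply: VRI; constructor.
exact: IH.
Qed.

Lemma modified_refl D : modified 0 0 D D.
Proof. by elim: D => [|s D IH]; constructor. Qed.

Lemma tower_modified m n : modified 0 m (tower false m n) (tower true m n).
Proof.
do 2 apply: modified_keep; elim: m => [|m IH]; first exact: modified_refl.
by rewrite !repeatS; apply: modified_keep; apply: modified_change.
Qed.

(** * The towers have one component *)

Definition low_crossing (s : slice) : bool :=
  if s is (i, Cross _) then (i <= 1)%N else false.

Definition connected (D : diagram) : nat * nat -> nat * nat -> Prop :=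
  clos_refl_sym_trans _ (strand_piece D).

Lemma low_crossing_below D k p s : onth D k = Some s -> low_crossing s ->
  width D k = 4%N -> (p < 4)%N ->
  exists2 q, (q < 4)%N & connected D (k, q) (k.+1, p).
Proof.
case: s => i [||c] //= Dk le_i Wk lt_p.
have [lt_pi|] := ltnP p i.
  by exists p => //; apply: rst_step; apply: piece_left Dk _.
rewrite leq_eqVlt => /orP[/eqP <-|].
  by exists i.+1; [lia | apply: rst_step; apply: piece_falling Dk].
rewrite leq_eqVlt => /orP[/eqP <-|lt_ip].
  by exists i; [lia | apply: rst_step; apply: piece_rising Dk].
exists p => //; apply: rst_step; rewrite -(subnKC lt_ip) -addn2.
by apply: (piece_right Dk); rewrite Wk /=; lia.
Qed.

Lemma low_crossing_right D k s : onth D k = Some s -> low_crossing s ->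
  width D k = 4%N -> connected D (k, 3%N) (k.+1, 3%N).
Proof.
case: s => i [||c] //= Dk le_i Wk; apply: rst_step.
have := @piece_right _ _ _ _ (1 - i)%N Dk; rewrite Wk /=.
by rewrite addnAC subnKC //; apply.
Qed.

Lemma onth_shift T (below D above : seq T) k :
  (k < size D)%N -> onth (below ++ D ++ above) (size below + k) = onth D k.
Proof.
move=> lt_k; rewrite !onth_cat ltnNge leq_addr /= addKn lt_k //.
Qed.

(** Clasps avoid position 0, and a loop leads the strand away at its first crossing and back at its
    second. *)
Definition left_strand (L : diagram) : Prop := forall below above,
  connected (below ++ L ++ above)
    (size below, 0%N) (size below + size L, 0%N)%N.

Lemma left_strand_cat L L' :
  left_strand L -> left_strand L' -> left_strand (L ++ L').
Proof.
move=> HL HL' below above; rewrite size_cat addnA -catA.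
apply: rst_trans (HL below (L' ++ above)) _.
by have := HL' (below ++ L) above; rewrite size_cat -catA.
Qed.

Lemma left_strand_repeat m L : left_strand L -> left_strand (repeat m L).
Proof.
move=> HL; elim: m => [|m IH]; last exact: left_strand_cat.
by move=> below above; rewrite addn0; apply: rst_refl.
Qed.

Lemma left_strand_clasp b : left_strand (clasp b).
Proof.
move=> below above.
have on0 := @onth_shift _ below (clasp b) above 0 isT.
have on1 := @onth_shift _ below (clasp b) above 1 isT.
rewrite addn0 in on0; rewrite addn1 in on1; rewrite addn2.
apply: rst_trans (rst_step _ _ _ _ (piece_left on0 _)) _ => //.
by apply: rst_step; apply: piece_left on1 _.
Qed.

Lemma left_strand_loop : left_strand loop.
Proof.
move=> below above.
have on0 := @onth_shift _ below loop above 0 isT.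
have on1 := @onth_shift _ below loop above 1 isT.
rewrite addn0 in on0; rewrite addn1 in on1; rewrite addn2.
apply: rst_trans (rst_step _ _ _ _ (piece_rising on0)) _.
by apply: rst_step; apply: piece_falling on1.
Qed.

Section OneComponent.
Variable mid : diagram.
Hypothesis mid_low : all low_crossing mid.
Hypothesis mid_left : left_strand mid.

Let cups : diagram := [:: (0%N, Cup); (0%N, Cup)].
Let caps : diagram := [:: (1%N, Cap); (0%N, Cap)].
Let D : diagram := cups ++ mid ++ caps.
Let M := size mid.

Lemma width_mid j : width D (2 + j) =
  if (j <= M)%N then 4%N else if j == M.+1 then 2%N else 0%N.
Proof.
rewrite /width /D /M /=; elim: mid mid_low j => [|[i [||c]] s IH] //=.
  by move=> _ [|[|[|j]]].
by move=> /andP[_ /IH{}IH] [|j] //=; rewrite IH.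
Qed.

Lemma mid_onth j : (j < M)%N ->
  exists2 s, onth D (2 + j) = Some s & low_crossing s.
Proof.
move=> lt_j; exists (nth (0%N, Cup) mid j).
  by rewrite (onth_shift cups caps lt_j) onthE (nth_map (0%N, Cup)).
exact: (all_nthP _ mid_low).
Qed.

(** Following strands downwards reduces connectedness of the middle part to the four points just
    above the cups. *)
Lemma connected_below j p : (j <= M)%N -> (p < 4)%N ->
  exists2 q, (q < 4)%N & connected D (2%N, q) (2 + j, p)%N.
Proof.
elim: j p => [|j IH] p le_j lt_p; first by exists p => //; apply: rst_refl.
have [s on_j low] := mid_onth le_j.
have W : width D (2 + j) = 4%N by rewrite width_mid ltnW.
have [r lt_r rp] := low_crossing_below on_j low W lt_p.
have [q lt_q qr] := IH r (ltnW le_j) lt_r.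
by exists q => //; rewrite addnS; apply: rst_trans qr rp.
Qed.

Lemma right_strand j : (j <= M)%N -> connected D (2%N, 3%N) (2 + j, 3)%N.
Proof.
elim: j => [|j IH] le_j; first exact: rst_refl.
have [s on_j low] := mid_onth le_j.
have W : width D (2 + j) = 4%N by rewrite width_mid ltnW.
rewrite addnS; apply: rst_trans (IH (ltnW le_j)) _.
exact: low_crossing_right on_j low W.
Qed.

Lemma onth_caps j : (j < 2)%N -> onth D (2 + M + j) = onth caps j.
Proof.
move=> lt_j; have := @onth_shift _ (cups ++ mid) caps [::] j lt_j.
by rewrite cats0 -catA size_cat.
Qed.

Lemma tower_point k p : (p < width D k)%N -> connected D (2%N, 0%N) (k, p).
Proof.
have cup20 : connected D (2%N, 0%N) (2%N, 1%N).
  by apply: rst_step; apply: (@piece_cup _ 1 0).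
have cup10 : connected D (1%N, 0%N) (1%N, 1%N).
  by apply: rst_step; apply: (@piece_cup _ 0 0).
have up0 : connected D (1%N, 0%N) (2%N, 2%N).
  by apply: rst_step; apply: (@piece_right _ 1 0 Cup 0).
have up1 : connected D (1%N, 1%N) (2%N, 3%N).
  by apply: rst_step; apply: (@piece_right _ 1 0 Cup 1).
have onth_cap1 := @onth_caps 0 isT; rewrite addn0 in onth_cap1.
have onth_cap0 := @onth_caps 1 isT; rewrite addn1 in onth_cap0.
have cap0 : connected D (2 + M, 0)%N (3 + M, 0)%N.
  by apply: rst_step; apply: piece_left onth_cap1 _.
have cap3 : connected D (2 + M, 3)%N (3 + M, 1)%N.
  apply: rst_step; have := @piece_right _ _ _ _ 0 onth_cap1.
  by rewrite width_mid leqnn; apply.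
have cap01 : connected D (3 + M, 0)%N (3 + M, 1)%N.
  by apply: rst_step; apply: piece_cap onth_cap0.
have left_up : connected D (2%N, 0%N) (2 + M, 0)%N := mid_left cups caps.
have right_up : connected D (2%N, 3%N) (2 + M, 3)%N := right_strand (leqnn M).
have c0 : connected D (2%N, 0%N) (2%N, 0%N) by apply: rst_refl.
have c30 : connected D (2%N, 0%N) (3 + M, 0)%N by apply: rst_trans left_up cap0.
have c31 : connected D (2%N, 0%N) (3 + M, 1)%N by apply: rst_trans c30 cap01.
(* Up the left strand, across the top cap, down the right strand. This links the arcs of the two
   cups. *)
have c3 : connected D (2%N, 0%N) (2%N, 3%N).
  by apply: rst_trans c31 _; apply: rst_sym; apply: rst_trans right_up cap3.
have c11 : connected D (2%N, 0%N) (1%N, 1%N).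
  by apply: rst_trans c3 _; apply: rst_sym.
have c10 : connected D (2%N, 0%N) (1%N, 0%N).
  by apply: rst_trans c11 _; apply: rst_sym.
have c2 : connected D (2%N, 0%N) (2%N, 2%N) by apply: rst_trans c10 up0.
case: k => [|[|j]] //.
  by case: p => [|[|p]].
rewrite -[j.+2]/(2 + j)%N width_mid.
case: (leqP j M) => [le_j lt_p|lt_j].
  have [q lt_q qp] := connected_below le_j lt_p.
  by apply: rst_trans qp; case: q lt_q => [|[|[|[|q]]]].
case: eqP => [->|//]; rewrite !addnS => lt_p.
by case: p lt_p => [|[|p]].
Qed.

Lemma tower_one_component : one_component D.
Proof.
split=> // k p l q /tower_point Hp /tower_point Hq.
by apply: rst_trans Hq; apply: rst_sym.
Qed.

End OneComponent.

Lemma tower_knot b m n : knot_diagram (tower b m n).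
Proof.
split; first exact: tower_closed.
rewrite /tower catA; apply: tower_one_component.
  rewrite all_cat; apply/andP; split.
    by elim: m => [|m IH] //=.
  by elim: n => [|n IH] //=.
apply: left_strand_cat; apply: left_strand_repeat.
  exact: left_strand_clasp.
exact: left_strand_loop.
Qed.

(** * Unknotting index and distinctness of the knots *)

Definition tower_knot_type (m n : nat) : virtual_knot :=
  VirtualKnot (ex_intro2 _ _ (tower false m n) (tower_knot false m n) erefl).

(** The writhe at [n] is [m] on [D] and 0 on the circle, and each crossing change moves it by at
    most 1. *)
Lemma tower_unknottable_ge m n k D : (0 < n)%N ->
  equivalent (tower false m n) D -> unknottable 0 k D -> (m <= k)%N.
Proof.
move=> n_gt0 eq_D [E mod_DE triv_E].
have n0 : n%:Z != 0 by lia.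
have /(equivalent_run _ n0 eq_D) run_D :
    run n%:Z (tower false m n) [::] [::] m%:Z.
  by apply/run_tower => //; rewrite eqxx.
have [w run_E le_k] := modified_run n0 mod_DE run_D.
have w0 : w = 0.
  move/(equivalent_run _ n0 triv_E): run_E.
  rewrite run_cup => -[x]; rewrite run_cap => -[_ []] //.
by move: le_k; rewrite w0; lia.
Qed.

Lemma tower_knot_type_diagrams m n :
  diagrams (tower_knot_type m n) (tower false m n).
Proof. by split; [exact: tower_knot | apply: rst_refl]. Qed.

Lemma tower_knot_type_inj m : (0 < m)%N ->
  injective (fun n => tower_knot_type m n.+1).
Proof.
move=> m_gt0 i j Kij; have := tower_knot_type_diagrams m i.+1.
rewrite Kij => -[_ eq_ij].
have i0 : i.+1%:Z != 0 by [].
have : run i.+1%:Z (tower false m i.+1) [::] [::] m%:Z.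
  by apply/run_tower => //; rewrite eqxx.
move/(equivalent_run _ i0 eq_ij)/(run_tower _ _ (ltn0Sn j) i0).
(* If [i] and [j] differed, the writhe at [i.+1] would be 0 for one diagram and [m > 0] for the
   other. *)
by case: eqP => /= ?; lia.
Qed.

Local Close Scope ring_scope.

Theorem theorem3p1 (m : nat) (hm : 0 < m) :
  exists K : nat -> virtual_knot,
    injective K /\ forall i : nat, unknotting_index (K i) (0, m).
Proof.
exists (fun n => tower_knot_type m n.+1); split=> [|n].
  exact: tower_knot_type_inj.
have lower_bound D (q : nat *l nat) : equivalent (tower false m n.+1) D ->
    unknottable q.1 q.2 D -> (((0, m) : nat *l nat) <= q)%O.
  (* A pair with positive first entry exceeds [(0, m)] in the dictionary order, so only unknotting
     without virtualization needs the writhe bound. *)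
  case: q => [[|q1] q2] eq_D; rewrite lexi_pair //= => unk.
  exact: tower_unknottable_ge eq_D unk.
split=> [|q [D [_ eq_D] [unk _]]]; last exact: lower_bound eq_D unk.
exists (tower false m n.+1); first exact: tower_knot_type_diagrams.
split=> [|q]; last by apply: lower_bound; apply: rst_refl.
by exists (tower true m n.+1); [exact: tower_modified | exact: tower_trivial].
Qed.
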